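(* Let $G$ be a finite $\mathbb{Z}$-module. Then for each $x\in \widehat{A_f(G)}$, the ideal $[x : G]$ is an essential ideal of $\mathbb{Z}$ if and only if $G$ is a finite abelian group which is not simple.
   Context: For a module $M$ over a commutative ring $R$ with $1\neq 0$ and $x\in M$, $[x:M]=\{r\in R : rM\subseteq Rx\}$, an ideal of $R$. An element $x\in M$ is a full-annihilator if either $x=0$ or $[x:M][y:M]M=0$ for some nonzero $y\in M$ with $[y:M]\neq R$. $A_f(M)$ is the set of full-annihilators of $M$ and $\widehat{A_f(M)}=A_f(M)\setminus\{0\}$. Here $R=\mathbb{Z}$ and $M=G$. An ideal is essential if it intersects every nonzero ideal non-trivially. *)

(* Defs.v *)
From HB Require Import structures.
From mathcomp Require Import all_boot all_order all_algebra all_fingroup.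
From mathcomp Require Import all_solvable classical_sets.

Set Implicit Arguments.
Unset Strict Implicit.
Unset Printing Implicit Defensive.

Import GRing.Theory.
Local Open Scope classical_set_scope.
Local Open Scope ring_scope.

(* The library's idealr_closed only describes proper ideals, whereas here the *)
(* improper ideal R is an ideal too (for instance [x : M] may be R).          *)
Definition is_ideal (R : comNzRingType) (I : set R) : Prop :=
  [/\ I 0,
      (forall a b, I a -> I b -> I (a + b)) &
      (forall r a, I a -> I (r * a))].

Definition essential_ideal (R : comNzRingType) (I : set R) : Prop :=
  is_ideal I /\
  (forall J : set R, is_ideal J -> J <> [set 0] -> I `&` J <> [set 0]).

(* I N, i.e. all finite sums of products a *: m with a in I and m in N. *)
Definition smul_set (R : comNzRingType) (M : lmodType R)
    (I : set R) (N : set M) : set M :=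
  [set z | exists (n : nat) (a : 'I_n -> R) (m : 'I_n -> M),
     [/\ (forall i, I (a i)), (forall i, N (m i)) &
         z = \sum_(i < n) a i *: m i]].

Definition ideal_prod (R : comNzRingType) (I J : set R) : set R :=
  @smul_set R R^o I J.

Definition cyclic_submod (R : comNzRingType) (M : lmodType R) (x : M) : set M :=
  [set s *: x | s in [set: R]].

(* Written [x : M] in the literature. *)
Definition residual (R : comNzRingType) (M : lmodType R) (x : M) : set R :=
  [set r | [set r *: m | m in [set: M]] `<=` cyclic_submod x].

Definition full_annihilators (R : comNzRingType) (M : lmodType R) : set M :=
  [set x | x = 0 \/
     exists y : M,
       [/\ y <> 0,
           residual y <> [set: R] &
           smul_set (ideal_prod (residual x) (residual y)) [set: M]
             = [set 0]]].
Arguments full_annihilators {R} M _.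

Definition nonzero_full_annihilators (R : comNzRingType) (M : lmodType R)
    : set M :=
  full_annihilators M `\ 0.
Arguments nonzero_full_annihilators {R} M _.

(* Main.v *)
Require Import Defs.
From mathcomp Require Import all_boot all_order all_algebra all_fingroup.
From mathcomp Require Import all_solvable classical_sets.

(** Both sides of the equivalence hold as soon as a nonzero full-annihilator
    exists.

    On the left, the order of the group kills it, so it is a nonzero element of
    every residual; and over a domain an ideal with a nonzero element is
    essential ([essential_ideal_neq0]), since it meets any other ideal in
    products.

    On the right, a nonzero full-annihilator [x] comes with a witness [y <> 0]
    whose residual is proper. In a simple abelian group every nonzero element
    is a generator, which makes its residual the whole ring
    ([residual_simple]); so the group is not simple. *)

Set Implicit Arguments.
Unset Strict Implicit.
Unset Printing Implicit Defensive.

Import GRing.Theory FinRing.Theory.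
Local Open Scope classical_set_scope.
Local Open Scope ring_scope.

Lemma residual_ideal (R : comNzRingType) (M : lmodType R) (x : M) :
  is_ideal (residual x).
Proof.
split=> [|a b Ia Ib|r a Ia] _ [m _ <-].
- by exists 0 => //; rewrite !scale0r.
- have [|s _ sE] := Ia (a *: m); first by exists m.
  have [|t _ tE] := Ib (b *: m); first by exists m.
  by exists (s + t) => //; rewrite !scalerDl sE tE.
- have [|s _ sE] := Ia (a *: m); first by exists m.
  by exists (r * s) => //; rewrite -!scalerA sE.
Qed.

(** A nonzero element of [I] times a nonzero element of [J] is a nonzero
    element of both ideals. *)
Lemma essential_ideal_neq0 (R : idomainType) (I : set R) (a : R) :
  is_ideal I -> I a -> a != 0 -> essential_ideal I.
Proof.
move=> idI Ia a0; split=> // J [J0 _ JM] Jneq0 IJ0; apply: Jneq0.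
apply/seteqP; split=> [b Jb|_ ->] //=.
have : (I `&` J) (a * b).
  by case: idI => _ _ IM; split; [rewrite mulrC; exact: IM | exact: JM].
by rewrite IJ0 /= => /eqP; rewrite mulf_eq0 (negbTE a0) => /eqP.
Qed.

Section FiniteIntModule.

Variable G : finLmodType int.

Lemma residual_card (x : G) : residual x #|G|%:Z.
Proof.
move=> _ [m _ <-]; exists 0 => //.
rewrite scale0r -natz scaler_nat -zmodXgE -cardsT.
by apply/esym/(@expg_cardG _ [set: G]%G); rewrite finset.in_setT.
Qed.

Lemma residual_essential (x : G) : essential_ideal (residual x).
Proof.
apply: essential_ideal_neq0 (residual_ideal x) (residual_card x) _.
by rewrite -natz Num.Theory.pnatr_eq0 -lt0n; apply/card_gt0P; exists x.
Qed.

(** By simplicity the cyclic subgroup of [y], normal and nontrivial, is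
    everything. *)
Lemma residual_simple (y : G) :
  simple [set: G]%SET -> y != 0 -> residual y = [set: int].
Proof.
move=> /simpleP[_ simG] y0; apply/seteqP; split=> // r _ _ [m _ <-].
have ycG : (<[y]> = [set: G]%SET)%g.
  have [|/eqP y1|//] := simG <[y]>%G.
    by rewrite -sub_abelian_normal ?finset.subsetT // zmod_abelian.
  by move: y1; rewrite cycle_eq1 (negbTE y0).
have /cycleP[k ->] : r *: m \in <[y]>%g by rewrite ycG finset.in_setT.
by exists k%:Z => //; rewrite zmodXgE -natz scaler_nat.
Qed.

End FiniteIntModule.

Theorem proposition2p2 (G : finLmodType int) :
  forall x : G,
  nonzero_full_annihilators G x ->
  (essential_ideal (residual x) <->
   (abelian [set: G]%SET /\ ~~ simple [set: G]%SET)).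
Proof.
move=> x [[x0 /(_ x0)//|[y [/eqP y0 yR _]]] _].
split=> _; last exact: residual_essential.
split; first exact: zmod_abelian.
by apply/negP => simG; apply: yR; exact: residual_simple.
Qed.
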